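(* Let $A=k_{\mathfrak M}\langle x_1,\ldots,x_n\rangle$ be the free algebra of a variety $\mathfrak M$ of $m$-ary algebras over a field $k$, freely generated by $x_1,\ldots,x_n$, and let $\mathscr{L}(A)$ be the space $\mathrm{Der}_kA$ of all $k$-linear derivations of $A$ equipped with the bilinear product determined by $(a\partial_i)\cdot(b\partial_j)=((a\partial_i)(b))\partial_j$ for $a,b\in A$, $1\le i,j\le n$. Then: (i) $\mathscr{L}(A)$ is a left-symmetric algebra; (ii) the commutator algebra of $\mathscr{L}(A)$, i.e. the space $\mathscr{L}(A)$ with the operation $[u,v]=u\cdot v-v\cdot u$, is the Lie algebra $\mathrm{Der}_kA$ of all derivations of $A$ (with its usual bracket $\{u,v\}(a)=u(v(a))-v(u(a))$).
   Context: Let $m\ge 2$. An $m$-ary algebra over $k$ is a $k$-vector space with one $m$-ary multilinear operation $\langle\cdot,\ldots,\cdot\rangle$; a derivation is a $k$-linear map satisfying the Leibniz rule for this operation. If $m=2$ and $\mathfrak M$ is a unitary variety (a variety of algebras with identity element), $A$ is assumed to contain an identity element $1$. Convention: varieties are nontrivial and such that free algebras are graded by degrees in the free generators and every map from the free generators to the free algebra extends uniquely to a derivation (automatic if $k$ is infinite). For a column $F=(f_1,\ldots,f_n)'$ of elements of $A$, $D_F=f_1\partial_1+\cdots+f_n\partial_n$ denotes the unique derivation of $A$ with $D_F(x_i)=f_i$ for all $i$; in particular $a\partial_i$ is the derivation with $x_i\mapsto a$ and $x_j\mapsto 0$ for $j\ne i$. Every derivation of $A$ has a unique expression of the form $D_F$.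 A (binary) algebra $B$ over $k$ is left-symmetric if $(xy)z-x(yz)=(yx)z-y(xz)$ for all $x,y,z\in B$. *)

(* Defs.v *)
From HB Require Import structures.
From mathcomp Require Import all_boot all_algebra.
From mathcomp Require Import boolp classical_sets functions.

Set Implicit Arguments.
Unset Strict Implicit.
Unset Printing Implicit Defensive.

Import GRing.Theory.
Local Open Scope ring_scope.

Definition upd (m : nat) (T : Type) (v : {ffun 'I_m -> T}) (i : 'I_m) (x : T) :
  {ffun 'I_m -> T} := [ffun j => if j == i then x else v j].

(* The flag [u] tells whether an identity element belongs to the signature; it
   is only meant to be used when [m = 2], where the two instances [i = 0, 1] of
   [algebra_oneP] read [a 1 = a] and [1 a = a]. *)
Record algebra (k : fieldType) (m : nat) (u : bool) := Algebra {
  algebra_sort :> lmodType k;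
  algebra_op : {ffun 'I_m -> algebra_sort} -> algebra_sort;
  algebra_opP : forall (i : 'I_m) (v : {ffun 'I_m -> algebra_sort}),
    linear (fun x => algebra_op (upd v i x));
  algebra_one : u -> algebra_sort;
  algebra_oneP : forall (hu : u) (i : 'I_m) (a : algebra_sort),
    algebra_op (upd [ffun => algebra_one hu] i a) = a
}.

Section Morphisms.
Variables (k : fieldType) (m : nat) (u : bool).
Implicit Types A B : algebra k m u.

Definition algebra_hom A B (f : A -> B) : Prop :=
  [/\ linear f,
      forall v : {ffun 'I_m -> A},
        f (algebra_op v) = algebra_op [ffun i => f (v i)]
    & forall hu : u, f (algebra_one A hu) = algebra_one B hu].

Definition derivation A (D : A -> A) : Prop :=
  linear D /\
  forall v : {ffun 'I_m -> A},
    D (algebra_op v) = \sum_(i < m) algebra_op (upd v i (D (v i))).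

End Morphisms.

Section Derivations.
Variables (k : fieldType) (m : nat) (u : bool) (A : algebra k m u).

Definition derivation_pred : {pred A -> A} := fun D => `[< derivation D >].

Lemma derivation_predP (D : A -> A) :
  reflect (derivation D) (D \in derivation_pred).
Proof. exact: asboolP. Qed.

Lemma algebra_op_upd_lin (v : {ffun 'I_m -> A}) i c (y z : A) :
  algebra_op (upd v i (c *: y + z)) =
  c *: algebra_op (upd v i y) + algebra_op (upd v i z).
Proof. exact: (algebra_opP i v c y z). Qed.

Lemma derivation_submod_closed : submod_closed derivation_pred.
Proof.
split=> [|c f g /derivation_predP[fl fP] /derivation_predP[gl gP]].
  apply/derivation_predP; split=> [c y z|v]; first by rewrite scaler0 addr0.
  rewrite big1 // => i _.
  have := algebra_op_upd_lin v i 0 0 0; rewrite !scale0r !add0r.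
  by have := algebra_op_upd_lin v i (-1) 0 0; rewrite scaler0 addr0 scaleN1r addNr.
apply/derivation_predP; split=> [d y z|v].
  rewrite /= !fctE fl gl !scalerDr !scalerA (mulrC c d) -!scalerA.
  by rewrite addrACA.
rewrite /= !fctE fP gP scaler_sumr -big_split; apply: eq_bigr => i _ /=.
by rewrite -algebra_op_upd_lin.
Qed.

HB.instance Definition _ :=
  GRing.isSubmodClosed.Build k (A -> A) derivation_pred derivation_submod_closed.

Record Der := DerSub { der_val :> A -> A; der_valP : der_val \in derivation_pred }.

HB.instance Definition _ := [isSub for der_val].
HB.instance Definition _ := [Choice of Der by <:].
HB.instance Definition _ := [SubChoice_isSubLmodule of Der by <:].

Lemma derP (D : Der) : derivation D.
Proof. exact/derivation_predP/der_valP. Qed.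

Fact der_bracket_subproof (D E : Der) :
  (fun a : A => D (E a) - E (D a)) \in derivation_pred.
Proof.
have linD (F : Der) c (y z : A) : F (c *: y + z) = c *: F y + F z.
  by have [Fl _] := derP F; exact: Fl.
have addD (F : Der) (y z : A) : F (y + z) = F y + F z.
  by have := linD F 1 y z; rewrite !scale1r.
have sumD (F : Der) (f : 'I_m -> A) :
    F (\sum_(i < m) f i) = \sum_(i < m) F (f i).
  apply: (big_morph F (addD F)).
  by have := addD F 0 0; rewrite addr0 => /eqP; rewrite -subr_eq subrr => /eqP.
have opDD (F G : Der) (v : {ffun 'I_m -> A}) : F (G (algebra_op v)) =
    \sum_(i < m) algebra_op (upd v i (F (G (v i)))) +
    \sum_(i < m) \sum_(j < m | j != i)
      algebra_op (upd (upd v i (G (v i))) j (F (v j))).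
  have [_ FP] := derP F; have [_ GP] := derP G.
  rewrite GP sumD -big_split; apply: eq_bigr => i _ /=.
  rewrite FP (bigD1 i) //=; congr (_ + _).
    congr algebra_op; apply/ffunP => j.
    by rewrite !ffunE eqxx; case: eqP.
  by apply: eq_bigr => j /negPf ji; rewrite [X in F X]ffunE ji.
apply/derivation_predP; split=> [c y z|v] /=.
  by rewrite !linD opprD addrACA -!scalerN -scalerDr.
rewrite !opDD opprD addrACA [X in _ + X](_ : _ = 0); last first.
  apply/eqP; rewrite subr_eq0 [eqbRHS](exchange_big_dep predT) //=.
  apply/eqP; apply: eq_bigr => i _.
  rewrite (eq_bigl (fun j => i != j)) => [|j]; last by rewrite eq_sym.
  apply: eq_bigr => j /negPf ij; congr algebra_op; apply/ffunP => l.
  by rewrite !ffunE; case: (eqVneq l j) => // ->; rewrite eq_sym ij.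
rewrite addr0 -sumrB; apply: eq_bigr => i _.
rewrite [LHS]addrC.
have := algebra_op_upd_lin v i (-1) (E (D (v i))) (D (E (v i))).
by rewrite !scaleN1r => <-; rewrite addrC.
Qed.

Definition der_bracket (D E : Der) : Der :=
  DerSub (der_bracket_subproof D E).

End Derivations.

Section Polynomials.
Variables (k : fieldType) (m : nat) (u : bool).

Inductive monomial (X : Type) : Type :=
  | MVar of X
  | MOne of u
  | MOp of {ffun 'I_m -> monomial X}.

(* A list stands for the linear combination of its entries. *)
Definition polynomial (X : Type) : Type := seq (k * monomial X).

Fixpoint monomial_eval (X : Type) (A : algebra k m u) (x : X -> A)
    (w : monomial X) : A :=
  match w with
  | MVar i => x i
  | MOne hu => algebra_one A hu
  | MOp f => algebra_op [ffun i => monomial_eval x (f i)]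
  end.

Definition polynomial_eval (X : Type) (A : algebra k m u) (x : X -> A)
    (p : polynomial X) : A :=
  \sum_(cw <- p) cw.1 *: monomial_eval x cw.2.

Fixpoint monomial_deg (X : eqType) (w : monomial X) (y : X) : nat :=
  match w with
  | MVar i => i == y
  | MOne _ => 0%N
  | MOp f => (\sum_(i < m) monomial_deg (f i) y)%N
  end.

(* [homogeneous x alpha] is the span of the monomials of multidegree [alpha]
   in the family [x]. *)
Definition homogeneous (X : choiceType) (A : algebra k m u) (x : X -> A)
    (alpha : X -> nat) (a : A) : Prop :=
  exists (d : nat) (c : 'I_d -> k) (w : 'I_d -> monomial X),
    (forall i, monomial_deg (w i) =1 alpha) /\
    a = \sum_(i < d) c i *: monomial_eval x (w i).

Record graded_by_degrees (X : choiceType) (A : algebra k m u) (x : X -> A) :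
    Prop := GradedByDegrees {
  graded_sum : forall a : A,
    exists (J : finType) (alpha : J -> X -> nat) (b : J -> A),
      (forall j, homogeneous x (alpha j) (b j)) /\ a = \sum_j b j;
  graded_direct : forall (J : finType) (alpha : J -> X -> nat) (b : J -> A),
    (forall i j, alpha i =1 alpha j -> i = j) ->
    (forall j, homogeneous x (alpha j) (b j)) ->
    \sum_j b j = 0 -> forall j, b j = 0;
  graded_op : forall (alpha : 'I_m -> X -> nat) (v : {ffun 'I_m -> A}),
    (forall i, homogeneous x (alpha i) (v i)) ->
    homogeneous x (fun y => \sum_(i < m) alpha i y)%N (algebra_op v);
  graded_one : forall hu : u, homogeneous x (fun=> 0%N) (algebra_one A hu)
}.

(* A variety is given by its identities [p = 0]; unitary varieties are those
   with [u = true]. *)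
Record variety := Variety {
  arity_ge2 : (2 <= m)%N;
  unitary_binary : u -> m = 2;
  identities : set (polynomial nat)
}.

Definition in_variety (M : variety) (A : algebra k m u) : Prop :=
  forall p, identities M p -> forall x : nat -> A, polynomial_eval x p = 0.

Definition is_free (M : variety) (X : choiceType) (A : algebra k m u)
    (x : X -> A) : Prop :=
  in_variety M A /\
  forall B : algebra k m u, in_variety M B -> forall y : X -> B,
    exists! f : A -> B, algebra_hom f /\ forall i, f (x i) = y i.

Record admissible (M : variety) : Prop := Admissible {
  admissible_nontrivial :
    exists2 A : algebra k m u, in_variety M A & exists a : A, a <> 0;
  admissible_graded : forall (X : choiceType) (A : algebra k m u) (x : X -> A),
    is_free M x -> graded_by_degrees x;
  admissible_der : forall (X : choiceType) (A : algebra k m u) (x : X -> A),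
    is_free M x -> forall f : X -> A, exists! D : Der A, forall i, D (x i) = f i
}.

End Polynomials.

Section LeftSymmetricProduct.
Variables (k : fieldType) (m : nat) (u : bool) (A : algebra k m u) (n : nat).
Variable x : 'I_n -> A.

(* D_F = f_1 d_1 + ... + f_n d_n, by unique choice; the default value 0 is
   irrelevant when [x] is a family of free generators of a free algebra of an
   admissible variety. [pder a i] is the special case a d_i. *)
Definition der_of (F : 'I_n -> A) : Der A :=
  xget 0 [set D : Der A | forall i, D (x i) = F i].

Definition pder (a : A) (i : 'I_n) : Der A :=
  der_of (fun j => if j == i then a else 0).

End LeftSymmetricProduct.

Section Products.
Variables (k : fieldType) (V : lmodType k) (mul : V -> V -> V).

Definition bilinear_product : Prop :=
  (forall z, linear (fun y => mul y z)) /\ (forall y, linear (mul y)).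

Definition left_symmetric_algebra : Prop :=
  bilinear_product /\
  forall a b c, mul (mul a b) c - mul a (mul b c) =
                mul (mul b a) c - mul b (mul a c).

Definition lie_algebra : Prop :=
  [/\ bilinear_product,
      forall a, mul a a = 0
    & forall a b c, mul a (mul b c) + mul b (mul c a) + mul c (mul a b) = 0].

Definition commutator (a b : V) : V := mul a b - mul b a.

End Products.

(* Only the values on the a d_i are prescribed; as these span Der A, at most one
   bilinear product satisfies the condition. *)
Definition is_L_product (k : fieldType) (m : nat) (u : bool)
    (A : algebra k m u) (n : nat) (x : 'I_n -> A)
    (mul : Der A -> Der A -> Der A) : Prop :=
  bilinear_product mul /\
  forall (a b : A) (i j : 'I_n),
    mul (pder x a i) (pder x b j) = pder x (pder x a i b) j.

(* Main.v *)
(* Derivations of A are determined by their values on the generators, and an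
   L-product is characterised by (D . E)(x_l) = D (E x_l). Hence D . E - E . D
   and {D, E} agree on the generators, so they are equal, which is (ii). Then
   the associator (a . b) . c - a . (b . c) takes at x_l the value
   (a . b)(w) - a (b w) with w = c x_l, and its symmetry in a and b is (ii)
   evaluated at w. *)
Require Import Defs.
From HB Require Import structures.
From mathcomp Require Import all_boot all_algebra.
From mathcomp Require Import boolp classical_sets.

Set Implicit Arguments.
Unset Strict Implicit.
Unset Printing Implicit Defensive.

Import GRing.Theory.
Local Open Scope ring_scope.

Section BilinearProducts.
Variables (k : fieldType) (V : lmodType k) (mul : V -> V -> V).
Hypothesis mul_bilinear : bilinear_product mul.

Lemma bilinear_product_suml (I : Type) (r : seq I) (F : I -> V) y :
  mul (\sum_(i <- r) F i) y = \sum_(i <- r) mul (F i) y.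
Proof.
have [linl _] := mul_bilinear.
pose f : {linear V -> V} :=
  HB.pack (mul^~ y) (GRing.isLinear.Build _ _ _ _ (mul^~ y) (linl y)).
exact: (linear_sum f).
Qed.

Lemma bilinear_product_sumr (I : Type) (r : seq I) (F : I -> V) y :
  mul y (\sum_(i <- r) F i) = \sum_(i <- r) mul y (F i).
Proof.
have [_ linr] := mul_bilinear.
pose f : {linear V -> V} :=
  HB.pack (mul y) (GRing.isLinear.Build _ _ _ _ (mul y) (linr y)).
exact: (linear_sum f).
Qed.

End BilinearProducts.

Section DerEvaluation.
Variables (k : fieldType) (m : nat) (u : bool) (A : algebra k m u).
Implicit Types D E : Der A.

HB.instance Definition _ D :=
  GRing.isLinear.Build k A A *:%R (der_val D) (derP D).1.

Lemma der_addE D E (a : A) : (D + E) a = D a + E a.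
Proof. by []. Qed.

Lemma der_oppE D (a : A) : (- D) a = - D a.
Proof. by []. Qed.

Lemma der_scaleE c D (a : A) : (c *: D) a = c *: D a.
Proof. by []. Qed.

Lemma der_zeroE (a : A) : (0 : Der A) a = 0.
Proof. by []. Qed.

Lemma der_sumE (I : Type) (r : seq I) (P : pred I) (F : I -> Der A) (a : A) :
  (\sum_(i <- r | P i) F i) a = \sum_(i <- r | P i) F i a.
Proof. exact: (big_morph (fun D : Der A => D a)). Qed.

Lemma der_inj D E : (forall a, D a = E a) -> D = E.
Proof. by move=> DE; apply/val_inj/funext. Qed.

Lemma der_bracketE D E (a : A) : der_bracket D E a = D (E a) - E (D a).
Proof. by []. Qed.

Lemma der_bracket_lie : lie_algebra (@der_bracket k m u A).
Proof.
split=> [|D|D E F].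
- by split=> D c E F; apply: der_inj => a;
    rewrite !(der_addE, der_scaleE, der_bracketE) linearP opprD addrACA
      scalerBr.
- by apply: der_inj => a; rewrite der_bracketE subrr.
apply: der_inj => a; rewrite !(der_addE, der_bracketE) der_zeroE.
rewrite (linearB D) (linearB E) (linearB F) /= !opprB !addrA.
(* Each of the six words in [D], [E], [F] occurs twice with opposite signs; the permutation puts the
   two copies side by side. *)
rewrite [LHS](ACl ((1*12)*(2*7)*(3*10)*(4*5)*(6*11)*(8*9))) /=.
by rewrite !(subrr, addNr, addr0).
Qed.

End DerEvaluation.

Section FreeGenerators.
Variables (k : fieldType) (m : nat) (u : bool) (A : algebra k m u) (n : nat).
Variable x : 'I_n -> A.
(** The form in which freeness enters: [admissible_der] supplies it for free generators. *)
Hypothesis x_der :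
  forall f : 'I_n -> A, exists! D : Der A, forall i, D (x i) = f i.
Implicit Types D E : Der A.

Lemma der_eq_gen D E : (forall i, D (x i) = E (x i)) -> D = E.
Proof.
move=> DE; have [F [_ uniqF]] := x_der (fun i => E (x i)).
by rewrite -(uniqF D DE) (uniqF E).
Qed.

Lemma der_of_gen (F : 'I_n -> A) i : der_of x F (x i) = F i.
Proof.
have [D [DF _]] := x_der F.
(* The extension [D] shows that the set in [der_of] is inhabited, so the default value [0] is never
   taken. *)
exact: (xgetPex 0 (ex_intro (fun E : Der A => forall l, E (x l) = F l) D DF)).
Qed.

Lemma der_of_unique (F : 'I_n -> A) D :
  (forall i, D (x i) = F i) -> der_of x F = D.
Proof. by move=> DF; apply: der_eq_gen => i; rewrite der_of_gen DF. Qed.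

Lemma pder_gen a i j : pder x a i (x j) = if j == i then a else 0.
Proof. exact: der_of_gen. Qed.

(** Reduces a bilinear product on [Der A] to its values on the [pder x a i]. *)
Lemma der_sum_pder D : D = \sum_i pder x (D (x i)) i.
Proof.
apply: der_eq_gen => l; rewrite der_sumE (bigD1 l) //= pder_gen eqxx.
by rewrite big1 ?addr0 // => i il; rewrite pder_gen eq_sym (negPf il).
Qed.

(** In coordinates, [D] times [D_F] is [D_G], where [G] is [D] applied entrywise to the column
    [F]. *)
Definition L_product D E : Der A := der_of x (fun l => D (E (x l))).

Lemma L_product_gen D E l : L_product D E (x l) = D (E (x l)).
Proof. exact: der_of_gen. Qed.

Lemma L_product_is_L_product : is_L_product x L_product.
Proof.
split=> [|a b i j].
  split=> D c E F; apply: der_eq_gen => l.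
    by rewrite !(der_addE, der_scaleE, L_product_gen).
  by rewrite !(der_addE, der_scaleE, L_product_gen) linearP.
apply: der_eq_gen => l; rewrite L_product_gen !pder_gen.
by case: eqP => // _; rewrite linear0.
Qed.

Section LProduct.
Variable mul : Der A -> Der A -> Der A.
Hypothesis mulL : is_L_product x mul.

(** Expand both factors in the [pder]: at [x l] only the component of [E] along [l] survives, and
    the sum over the components of [D] reassembles to [D]. *)
Lemma is_L_product_gen D E l : mul D E (x l) = D (E (x l)).
Proof.
have [mul_bilin mulP] := mulL.
rewrite {1}(der_sum_pder E) (bilinear_product_sumr mul_bilin) der_sumE.
rewrite (bigD1 l) //= big1 ?addr0 => [|j jl].
  rewrite {1}(der_sum_pder D) (bilinear_product_suml mul_bilin) der_sumE.
  rewrite {2}(der_sum_pder D) der_sumE; apply: eq_bigr => i _.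
  by rewrite mulP pder_gen eqxx.
(* For [j] different from [l], every term is some [pder x _ j], which vanishes at [x l]. *)
rewrite {1}(der_sum_pder D) (bilinear_product_suml mul_bilin) der_sumE.
by rewrite big1 // => i _; rewrite mulP pder_gen eq_sym (negPf jl).
Qed.

Lemma commutator_L_product D E : commutator mul D E = der_bracket D E.
Proof.
by apply: der_eq_gen => l; rewrite der_addE der_oppE !is_L_product_gen.
Qed.

Lemma left_symmetric_L_product : left_symmetric_algebra mul.
Proof.
split=> [|D E F]; first by case: mulL.
apply: der_eq_gen => l.
rewrite !der_addE !der_oppE !is_L_product_gen; set w := F (x l).
(* Since [w] need not be a generator, [mul D E w] has no direct formula; the commutator identity
   trades it for [der_bracket D E w + mul E D w]. *)
have := congr1 (fun G : Der A => G w) (commutator_L_product D E).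
rewrite der_addE der_oppE /= => /(canRL (subrK _)) ->.
by rewrite addrC addrA addrA addNr add0r addrC.
Qed.

End LProduct.
End FreeGenerators.

Theorem lemma1 (k : fieldType) (m : nat) (u : bool) (M : variety k m u)
    (HM : admissible M) (n : nat) (A : algebra k m u) (x : 'I_n -> A)
    (Afree : is_free M x) :
  (exists! mul : Der A -> Der A -> Der A, is_L_product x mul) /\
  forall mul : Der A -> Der A -> Der A, is_L_product x mul ->
    left_symmetric_algebra mul /\
    (lie_algebra (commutator mul) /\
     forall D E : Der A, commutator mul D E = der_bracket D E).
Proof.
have x_der := admissible_der HM Afree; split.
  exists (L_product x); split; first exact: L_product_is_L_product.
  move=> mul mulL; apply/funext => D; apply/funext => E.
  by apply: der_of_unique => // l; exact: is_L_product_gen.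
move=> mul mulL; have comm := commutator_L_product x_der mulL.
split; first exact: (left_symmetric_L_product x_der mulL).
(* The Lie axioms are transported from [der_bracket], not derived from left symmetry. *)
split=> //; rewrite (_ : commutator mul = @der_bracket k m u A).
  exact: der_bracket_lie.
by apply/funext => D; apply/funext => E.
Qed.
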